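(* Let $G$ be a bridgeless cubic graph, let $M$ be a perfect matching of $G$, and let $A,B,C$ be three pairwise disjoint $M$-balanced matchings forming a good family. Then $\tau(G)\le 4$.
   Context: For a bridgeless cubic graph $G$, $\tau(G)$ is the minimum number of perfect matchings of $G$ whose union is $E(G)$. Given a perfect matching $M$ of $G$, a set $A\subseteq E(G)$ is an $M$-balanced matching if there is a perfect matching $M'$ of $G$ with $A=M\cap M'$. Note that $G\setminus M$ (deleting the edges of $M$) is a $2$-factor, i.e. a disjoint union of cycles. Three pairwise disjoint $M$-balanced matchings $A,B,C$ form a good family if: (i) every odd cycle of $G\setminus M$ has, for each of the three sets $A,B,C$, exactly one vertex incident with an edge of that set, and the three paths into which these three vertices divide the cycle all have odd length; (ii) for every even cycle of $G\setminus M$, at least two of the sets $A,B,C$ have no edge incident to a vertex of the cycle. *)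

(* Defs.v *)
From HB Require Import structures.
From mathcomp Require Import all_boot.

Set Implicit Arguments.
Unset Strict Implicit.
Unset Printing Implicit Defensive.

(* Parallel edges are allowed. A loop at a vertex of degree 3 forces the third
   edge at that vertex to be a bridge, so excluding loops excludes no
   bridgeless cubic graph. *)
Record graph := Graph {
  vertex : finType;
  edge : finType;
  ends : edge -> {set vertex};
  card_ends : forall e, #|ends e| = 2 }.

Section Graphs.
Variable G : graph.
Implicit Types (M A B C S : {set edge G}) (vs : seq (vertex G)).

Definition cubic : Prop :=
  forall v : vertex G, #|[set e : edge G | v \in ends e]| = 3.

Definition adj S : rel (vertex G) :=
  fun x y => [exists e in S, ends e == [set x; y]].

Definition components S : nat := n_comp (adj S) predT.

Definition bridge (e : edge G) : bool :=
  components [set: edge G] < components (~: [set e]).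

Definition bridgeless : Prop := forall e : edge G, ~~ bridge e.

Definition perfect_matching M : bool :=
  [forall v : vertex G, #|[set e in M | v \in ends e]| == 1].

Definition matching_cover (F : {set {set edge G}}) : bool :=
  [forall M in F, perfect_matching M] && (cover F == [set: edge G]).

(* None if the perfect matchings of G do not cover its edges. *)
Definition tau : option nat :=
  if [pick F | matching_cover F] is Some F0
  then Some #|[arg min_(F < F0 | matching_cover F) #|F|]| else None.

Definition balanced M A : Prop :=
  exists2 M', perfect_matching M' & A = M :&: M'.

(* The edge es_i joins vs_i to vs_(i+1), indices being taken modulo the length
   size vs. Two parallel edges form a cycle of length 2. *)
Definition cycle_in S vs (es : seq (edge G)) : bool :=
  [&& 1 < size vs, uniq vs, uniq es, all [in S] es &
      all2 (fun e (xy : vertex G * vertex G) => ends e == [set xy.1; xy.2])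
           es (zip vs (rot 1 vs))].

Definition incident_on A vs : {set vertex G} :=
  [set v in vs | [exists e in A, v \in ends e]].

(* arc vs x y lists the vertices met from x, included, to y, excluded, so its
   size is the number of edges of that path. The paths into which T divides
   the cycle are those that have no vertex of T in their interior. *)
Definition odd_division vs (T : {set vertex G}) : Prop :=
  forall x y, x \in T -> y \in T -> x != y ->
    (forall z, z \in T -> z \in arc vs x y -> z = x) ->
    odd (size (arc vs x y)).

Definition good_family M A B C : Prop :=
  (forall vs es, cycle_in (~: M) vs es -> odd (size vs) ->
     [/\ #|incident_on A vs| = 1, #|incident_on B vs| = 1,
         #|incident_on C vs| = 1 &
         odd_division vs (incident_on (A :|: B :|: C) vs)])
  /\
  (forall vs es, cycle_in (~: M) vs es -> ~~ odd (size vs) ->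
     2 <= count (fun X => incident_on X vs == set0) [:: A; B; C]).

End Graphs.

Arguments cubic : clear implicits.
Arguments bridgeless : clear implicits.
Arguments tau : clear implicits.

(* Main.v *)
(** If [M :&: X = A] for a perfect matching [X], then along a cycle of [G \ M]
    the edges alternate between [X] and its complement, except at the vertices
    incident with [A], where neither of the two edges is in [X].  Choose
    perfect matchings [X], [Y], [Z] with traces [A], [B], [C] on [M] whose union
    is as large as possible, and suppose that [e], not in [M], is uncovered.
    If the cycle through [e] is even, two of the traces, say [A] and [B], avoid
    it; replacing [X] on this cycle by the complement of [Y] enlarges the union.
    If it is odd, number its vertices starting at an end of [e] so that [e] is
    the first edge: by alternation the vertices of [A], [B], [C] have
    positions that are [0] or odd, so two consecutive ones are both odd, and the
    path between them is even.  Hence [M], [X], [Y], [Z] cover [G]. *)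

Require Import Defs.
From mathcomp Require Import all_boot.
From mathcomp Require Import zify.

Set Implicit Arguments.
Unset Strict Implicit.
Unset Printing Implicit Defensive.

(** * Two-element sets *)

Section OtherElement.
Variable T : finType.
Implicit Types (P : {set T}) (x y : T).

Definition other P x : T := odflt x [pick y in P :\ x].

Lemma otherP P x : #|P| = 2 -> x \in P ->
  [/\ other P x \in P, other P x != x & P = [set x; other P x]].
Proof.
move=> P2 Px; rewrite /other; case: pickP => [y|none] /=.
  rewrite !inE => /andP[yx Py]; split=> //.
  apply/esym/eqP; rewrite eqEcard subUset !sub1set Px Py P2 cards2 /=.
  by rewrite eq_sym yx.
by move: P2; rewrite (cardsD1 x) Px (eq_card0 none).
Qed.

Lemma otherE P x y : #|P| = 2 -> x \in P -> y \in P -> y != x ->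
  y = other P x.
Proof.
move=> P2 Px Py yx; have [_ _ defP] := otherP P2 Px.
by move: Py; rewrite {1}defP !inE (negPf yx) => /eqP.
Qed.

Lemma otherK P x : #|P| = 2 -> x \in P -> other P (other P x) = x.
Proof.
move=> P2 Px; have [Po ox _] := otherP P2 Px.
by rewrite -(otherE P2 Po Px) // eq_sym.
Qed.

End OtherElement.

(** * Orbits of a product of two involutions *)

Section InvolutionPair.
Variables (T : finType) (D : {pred T}) (a b : T -> T).
Hypotheses (aK : involutive a) (bK : involutive b).
Hypotheses (Da : {homo a : x / x \in D}) (Db : {homo b : x / x \in D}).
Hypotheses (a_free : {in D, forall x, a x != x}).
Hypotheses (b_free : {in D, forall x, b x != x}).

Let f := b \o a.

Lemma comp_invol_inj : injective f.
Proof. exact: inj_comp (inv_inj bK) (inv_inj aK). Qed.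

Lemma iter_comp_invol k x : x \in D -> iter k f x \in D.
Proof. by move=> Dx; elim: k => //= k IH; apply/Db/Da. Qed.

(* [b] reverses the orbits of [f], so [iter k f x = b x] would force a fixed
   point of [a] or of [b] halfway between [x] and [b x]. *)
Lemma iter_comp_invol_neq k x : x \in D -> iter k f x != b x.
Proof.
have [m] := ubnP k; elim: m k x => // m IH [|[|k]] x lt_km Dx.
- by rewrite eq_sym; apply: b_free.
- by rewrite /= (inj_eq (inv_inj bK)); apply: a_free.
have -> : b x = f (b (f x)) by rewrite /f /= bK aK.
rewrite iterS (inj_eq comp_invol_inj) iterSr; apply: IH; first exact: ltnW.
exact/Db/Da.
Qed.

(** Applied to [flip] and [turn] below, this and [orbit_invol_r] say that an orbit runs around its
    cycle in one direction only, so it repeats neither a vertex nor an edge. *)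
Lemma orbit_invol_l x y : x \in D -> y \in orbit f x -> y != b x.
Proof.
move=> Dx; rewrite -fconnect_orbit => /iter_findex <-.
exact: iter_comp_invol_neq.
Qed.

Lemma orbit_invol_r x y : x \in D -> y \in orbit f x -> y != a x.
Proof.
move=> Dx; rewrite -fconnect_orbit => /iter_findex <-.
(* One more step from [a x] would lead to [b (a (a x)) = b x]. *)
apply: contraNneq (iter_comp_invol_neq (findex f x y).+1 Dx) => def_y.
by rewrite iterS def_y /f /= aK.
Qed.

End InvolutionPair.

(** Turns the cyclic shift in [cycle_in] into an application of [f]. *)
Lemma rot1_orbit (T : finType) (f : T -> T) x : injective f ->
  rot 1 (orbit f x) = map f (orbit f x).
Proof.
move=> injf; rewrite /orbit.
have := iter_order injf x; have := order_gt0 f x.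
case: (order f x) => // n _ fnx.
have def_x : rcons (traject f (f x) n) x = traject f (f x) n.+1.
  by rewrite trajectSr -iterSr fnx.
rewrite trajectS rot1_cons def_x -trajectS.
by elim: n.+1 (x) => //= m IH y; rewrite -IH.
Qed.

(** * Cycles of a 2-regular multigraph *)

Section TwoRegular.
Variables (G : graph) (S : {set edge G}).
Hypothesis S2 : forall v, #|[set e in S | v \in ends e]| = 2.

(** A dart is an edge of [S] with a chosen end; darts keep parallel edges apart. *)
Let dart : {pred vertex G * edge G} := [pred d | d.2 \in S & d.1 \in ends d.2].

(** Like [turn], it is the identity off darts, which makes it an involution of the whole type. *)
Let flip (d : vertex G * edge G) :=
  if d \in dart then (other (ends d.2) d.1, d.2) else d.

Let turn (d : vertex G * edge G) :=
  if d \in dart then (d.1, other [set e in S | d.1 \in ends e] d.2) else d.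

Lemma flip_dart d : d \in dart -> flip d \in dart.
Proof.
move=> Dd; rewrite /flip Dd; case/andP: Dd => Se ve.
by have [ov _ _] := otherP (card_ends d.2) ve; apply/andP.
Qed.

Lemma turn_dart d : d \in dart -> turn d \in dart.
Proof.
move=> Dd; rewrite /turn Dd; case/andP: Dd => Se ve.
have [] := @otherP _ [set e in S | d.1 \in ends e] d.2 (S2 _).
  by rewrite inE Se.
by rewrite inE => ? _ _.
Qed.

Lemma flipK : involutive flip.
Proof.
move=> d; rewrite {2}/flip; case: ifP => Dd; last by rewrite /flip Dd.
have:= flip_dart Dd; rewrite {1}/flip Dd => Dd'; rewrite /flip Dd' /=.
case/andP: Dd => _ ve; rewrite otherK ?card_ends //; by case: (d).
Qed.

Lemma turnK : involutive turn.
Proof.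
move=> d; rewrite {2}/turn; case: ifP => Dd; last by rewrite /turn Dd.
have:= turn_dart Dd; rewrite {1}/turn Dd => Dd'; rewrite /turn Dd' /=.
rewrite otherK ?S2 //; first by case: (d).
by rewrite inE; case/andP: Dd => -> ->.
Qed.

Lemma flip_free : {in dart, forall d, flip d != d}.
Proof.
move=> [v e] Dd; rewrite /flip Dd; case/andP: Dd => /= _ ve.
have [_ ov _] := otherP (card_ends e) ve.
by apply: contra_neq ov => -[->].
Qed.

Lemma turn_free : {in dart, forall d, turn d != d}.
Proof.
move=> [v e] Dd; rewrite /turn Dd; case/andP: Dd => /= Se ve.
have [|_ oe _] := @otherP _ [set e in S | v \in ends e] e (S2 _).
  by rewrite inE Se.
by apply: contra_neq oe => -[->].
Qed.

Lemma dart_fst_eq c d : c \in dart -> d \in dart -> c.1 = d.1 ->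
  c = d \/ c = turn d.
Proof.
case: c d => [v e] [w e'] Dc Dd /= def_v; rewrite -{w}def_v in Dd *.
have [-> | ee'] := eqVneq e e'; [by left | right].
rewrite /turn Dd /=; congr pair; case/andP: Dc Dd => /= Se ve /andP[/= Se' ve'].
by apply: otherE => //; rewrite inE ?Se ?Se'.
Qed.

Lemma dart_snd_eq c d : c \in dart -> d \in dart -> c.2 = d.2 ->
  c = d \/ c = flip d.
Proof.
case: c d => [v e] [w e'] Dc Dd /= def_e; rewrite -{e'}def_e in Dd *.
have [-> | vw] := eqVneq v w; [by left | right].
rewrite /flip Dd /=; congr pair; case/andP: Dc Dd => /= Se ve /andP[/= _ we].
by apply: otherE => //; apply: card_ends.
Qed.

(** The orbit of a dart of [e0] under [turn \o flip] crosses an edge, then turns to the next one;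
    its two projections list the vertices and the edges of the cycle. *)
Lemma cycle_through e0 : e0 \in S ->
  exists vs es, cycle_in S vs (e0 :: es).
Proof.
move=> Se0; have /card_gt0P[v0 v0e0]: 0 < #|ends e0| by rewrite card_ends.
pose d0 := (v0, e0); have Dd0 : d0 \in dart by apply/andP.
pose f := turn \o flip; pose o := orbit f d0.
have injf : injective f := comp_invol_inj flipK turnK.
have Do : {subset o <= dart}.
  move=> d; rewrite -fconnect_orbit => /iter_findex <-.
  exact: (iter_comp_invol flip_dart turn_dart).
have def_o : o = d0 :: behead o by rewrite /o /orbit -orderSpred.
have orbit_sym c d : c \in o -> d \in o -> c \in orbit f d.
  rewrite -!fconnect_orbit => c_o d_o.
  by rewrite (connect_trans _ c_o) // fconnect_sym.
exists (map fst o), (map snd (behead o)).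
have -> : e0 :: map snd (behead o) = map snd o by rewrite [in RHS]def_o.
have fst_f d : d \in o -> (f d).1 = other (ends d.2) d.1.
  move=> /Do Dd; rewrite /f /= /turn flip_dart //= /flip Dd //.
apply/and5P; split.
- have fd0 : f d0 \in o by rewrite -fconnect_orbit fconnect1.
  have : f d0 != d0.
    apply/eqP=> /(congr1 fst); rewrite fst_f /o ?in_orbit //=.
    by apply/eqP; have [] := otherP (card_ends e0) v0e0.
  rewrite size_map; move: fd0; rewrite def_o inE.
  by case: (behead o) => //=; rewrite orbF => ->.
- rewrite map_inj_in_uniq ?orbit_uniq // => c d co do_ eq_cd.
  (* Distinct darts of the orbit with a common vertex would be exchanged by [turn], against
     [orbit_invol_l]. *)
  have [//|def_c] := dart_fst_eq (Do _ co) (Do _ do_) eq_cd.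
  have := orbit_invol_l flipK turnK flip_dart turn_dart flip_free turn_free.
  by move/(_ _ _ (Do _ do_) (orbit_sym _ _ co do_)); rewrite def_c eqxx.
- rewrite map_inj_in_uniq ?orbit_uniq // => c d co do_ eq_cd.
  have [//|def_c] := dart_snd_eq (Do _ co) (Do _ do_) eq_cd.
  have := orbit_invol_r flipK turnK flip_dart turn_dart flip_free turn_free.
  by move/(_ _ _ (Do _ do_) (orbit_sym _ _ co do_)); rewrite def_c eqxx.
- by rewrite all_map; apply/allP=> d /Do /andP[].
rewrite -map_rot (rot1_orbit d0 injf) -map_comp -/o.
have {def_o orbit_sym} : {in o, forall d, ends d.2 = [set d.1; (f d).1]}.
  move=> d do_; rewrite fst_f //; case/Do/andP: do_ => _ ve.
  by have [] := otherP (card_ends d.2) ve.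
elim: o {Do fst_f} => //= d o IH ends_o.
rewrite ends_o ?mem_head // eqxx /=; apply: IH => c co.
by rewrite ends_o // inE co orbT.
Qed.

End TwoRegular.

Lemma perfect_matchingP (G : graph) (X : {set edge G}) :
  reflect (forall v, #|[set e in X | v \in ends e]| = 1) (perfect_matching X).
Proof. by apply: (iffP forallP) => pmX v; apply/eqP. Qed.

Lemma card_set2I (T : finType) (s t : T) (X : {set T}) : s != t ->
  #|[set s; t] :&: X| = (s \in X) + (t \in X).
Proof.
move=> st; rewrite (cardsD1 s) (cardsD1 t) !inE !eqxx orbT /= [t == s]eq_sym st /=.
rewrite (_ : _ :\: _ = set0) ?cards0 ?addn0 //.
by apply/setP=> x; rewrite !inE; do 2!case: eqP.
Qed.

(** * Matchings along a cycle of [G \ M] *)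

Section Cycle.
Variables (G : graph) (M : {set edge G}).
Hypothesis M2 : forall v, #|[set e in ~: M | v \in ends e]| = 2.
Variables (v0 : vertex G) (e0 : edge G) (vs : seq (vertex G)) (es : seq (edge G)).
Hypothesis cyc : cycle_in (~: M) vs es.

Let n := size vs.
(** Indices are read modulo [n], so that [g i] joins [w i] to [w i.+1] for every [i]; as [0 < n],
    the default [v0] is never returned. *)
Let w i := nth v0 vs (i %% n).
Let g i := nth e0 es (i %% n).

Lemma cycle_size_gt1 : 1 < n. Proof. by case/and5P: cyc. Qed.

Let n_gt0 : 0 < n. Proof. exact: ltnW cycle_size_gt1. Qed.

Lemma size_cycle_edges : size es = n.
Proof.
case/and5P: cyc => _ _ _ _; rewrite all2E => /andP[/eqP-> _].
by rewrite size_zip size_rot minnn.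
Qed.

Lemma cycle_edge_in i : g i \in es.
Proof. by rewrite mem_nth // size_cycle_edges ltn_mod. Qed.

Lemma cycle_vertex_in i : w i \in vs.
Proof. by rewrite mem_nth // ltn_mod. Qed.

Lemma cycle_edge_notin e : e \in es -> e \notin M.
Proof. by case/and5P: cyc => _ _ _ /allP sub_es _ /sub_es; rewrite inE. Qed.

Lemma nth_rot1 i : i < n -> nth v0 (rot 1 vs) i = w i.+1.
Proof.
rewrite /w /n; case: vs => // x s; rewrite rot1_cons nth_rcons /= ltnS => le_i.
by case: ltngtP le_i => // [lt_i _ | -> _]; rewrite ?modnn // modn_small.
Qed.

Lemma cycle_ends i : ends (g i) = [set w i; w i.+1].
Proof.
case/and5P: cyc => _ _ _ _; rewrite all2E => /andP[_ /all_nthP ends_es].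
have lt_i : i %% n < n by rewrite ltn_mod.
have sz : size (zip vs (rot 1 vs)) = n by rewrite size_zip size_rot minnn.
have := ends_es (e0, (v0, v0)) (i %% n).
rewrite size_zip sz size_cycle_edges minnn lt_i => /(_ isT).
rewrite nth_zip ?sz ?size_cycle_edges // nth_zip ?size_rot //= nth_rot1 //.
by move=> /eqP ->; rewrite /w -addn1 modnDml addn1.
Qed.

Lemma cycle_edge_succ i : g i != g i.+1.
Proof.
case/and5P: cyc => n1 _ uniq_es _ _.
rewrite /g nth_uniq ?size_cycle_edges ?ltn_mod //.
apply/eqP => /esym/eqP; rewrite -addn1 -[X in _ == X %[mod _]]addn0 eqn_modDl.
by rewrite modn_small // mod0n.
Qed.

(** The two cycle edges at this vertex are distinct and outside [M], where [M2] allows only two. *)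
Lemma cycle_edges_at i :
  [set e in ~: M | w i.+1 \in ends e] = [set g i; g i.+1].
Proof.
apply/esym/eqP; rewrite eqEcard M2 cards2 cycle_edge_succ andbT.
by rewrite subUset !sub1set !inE !cycle_ends !inE !eqxx orbT
           !cycle_edge_notin ?cycle_edge_in.
Qed.

Lemma cycle_indexP v : v \in vs -> exists i, v = w i.+1.
Proof.
(* Adding [n.-1] rather than subtracting 1 also serves the first vertex. *)
move=> v_vs; exists (index v vs + n.-1); rewrite -addnS prednK // /w modnDr.
by rewrite modn_small ?nth_index // index_mem.
Qed.

Lemma cycle_edge_indexP e : e \in es -> exists i, e = g i.
Proof.
move=> e_es; exists (index e es).
by rewrite /g modn_small -?size_cycle_edges ?nth_index // index_mem.
Qed.

Lemma cycle_edge_ends e v : e \in es -> v \in ends e -> v \in vs.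
Proof.
move=> /cycle_edge_indexP[i ->]; rewrite cycle_ends !inE.
by case/orP=> /eqP->; apply: cycle_vertex_in.
Qed.

(** The single edge of [X] at [w i.+1] is one of the two cycle edges or belongs to [M]; the third
    summand counts the latter case. *)
Lemma matching_alternates X i : perfect_matching X ->
  (g i \in X) + (g i.+1 \in X) + (w i.+1 \in incident_on (M :&: X) vs) = 1.
Proof.
move=> /perfect_matchingP/(_ (w i.+1)) pmX; rewrite -card_set2I ?cycle_edge_succ //.
rewrite -cycle_edges_at -pmX inE cycle_vertex_in /=.
rewrite -(cardsID M [set e in X | _]) addnC; congr addn; last first.
  by apply: eq_card => e; rewrite !inE; case: (e \in M); rewrite ?andbF // andbC.
have : #|[set e in X | w i.+1 \in ends e] :&: M| <= 1.
  by rewrite -pmX subset_leq_card // subsetIl.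
case: existsP => [[e /andP[/setIP[Me Xe] we]] | none] le1.
  apply/esym/eqP; rewrite eqn_leq le1.
  by apply/card_gt0P; exists e; rewrite !inE Xe we Me.
apply/esym/eqP; rewrite cards_eq0; apply/eqP/setP=> e; rewrite !inE.
apply/negP=> /andP[/andP[Xe we] Me]; apply: none.
by exists e; rewrite inE Me Xe.
Qed.

(** Up to [a] the edges alternate, so [g i] is in [X] exactly for odd [i]; the edge just before [a]
    is not in [X], hence its index is even. *)
Lemma odd_trace_index X a : perfect_matching X ->
  incident_on (M :&: X) vs = [set a] -> nth e0 es 0 \notin X ->
  0 < index a vs -> odd (index a vs).
Proof.
move=> pmX def_a g0X a_gt0.
have a_vs : a \in vs.
  by have := set11 a; rewrite -def_a inE => /andP[].
have lt_a : index a vs < n by rewrite index_mem.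
have w_a i : i < n -> (w i == a) = (i == index a vs).
  move=> lt_i; rewrite /w modn_small // -[in LHS](nth_index v0 a_vs) nth_uniq //.
  by case/and5P: cyc.
have gX i : i < index a vs -> (g i \in X) = odd i.
  elim: i => [_|i IH lt_i]; first by rewrite /g mod0n (negPf g0X).
  have := matching_alternates i pmX; rewrite def_a in_set1.
  rewrite (w_a _ (ltn_trans lt_i lt_a)) (IH (ltnW lt_i)) (ltn_eqF lt_i) /=.
  by case: (g i.+1 \in X) (odd i) => [] [].
have := matching_alternates (index a vs).-1 pmX.
rewrite def_a in_set1 prednK // w_a // eqxx gX ?ltn_predL //.
have -> : odd (index a vs) = ~~ odd (index a vs).-1 by rewrite -oddS prednK.
by case: (odd _) (_ \in X) => [] [].
Qed.

(* In [Y] every vertex of the cycle has exactly one of its two cycle edges, so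
   the complement of [Y] has the other one. *)
Definition swap_on (X Y : {set edge G}) : {set edge G} :=
  X :\: [set e in es] :|: [set e in es] :\: Y.

Lemma swap_on_trace X Y : M :&: swap_on X Y = M :&: X.
Proof.
apply/setP=> e; rewrite !inE; case Me: (e \in M) => //=.
have -> : (e \in es) = false.
  by apply: contraTF Me => /cycle_edge_notin.
by rewrite andbF orbF.
Qed.

(** Off the cycle nothing changes, since edges of [es] have their ends in [vs]. At a cycle vertex
    [X] has no edge of [M], so the new set has there just the cycle edges outside [Y]: exactly one,
    by alternation. *)
Lemma swap_on_perfect X Y : perfect_matching X -> perfect_matching Y ->
  incident_on (M :&: X) vs = set0 -> incident_on (M :&: Y) vs = set0 ->
  perfect_matching (swap_on X Y).
Proof.
move=> pmX pmY X0 Y0; apply/perfect_matchingP=> v.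
have [v_vs | v_vs] := boolP (v \in vs); last first.
  rewrite -(perfect_matchingP _ pmX v); apply: eq_card => e; rewrite !inE.
  have [ve | //] := boolP (v \in ends e); last by rewrite !andbF.
  have -> : (e \in es) = false.
    by apply: contraNF v_vs => /cycle_edge_ends; apply.
  by rewrite andbF orbF.
have [i def_v] := cycle_indexP v_vs.
have -> : [set e in swap_on X Y | v \in ends e] = [set g i; g i.+1] :\: Y.
  apply/setP=> e; rewrite -cycle_edges_at -def_v !inE.
  have [ve | _] := boolP (v \in ends e); last by rewrite !andbF.
  rewrite !andbT; have [Me | Me] := boolP (e \in M); rewrite ?andbF ?andbT /=.
    have -> : (e \in es) = false by apply: contraTF Me => /cycle_edge_notin.
    rewrite andbF orbF; apply/negP=> Xe.
    have := in_set0 v; rewrite -X0 inE v_vs => /existsP[].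
    by exists e; rewrite !inE Me Xe.
  have -> : e \in es; last by rewrite andbT.
  have : e \in [set g i; g i.+1] by rewrite -cycle_edges_at -def_v !inE Me.
  by rewrite !inE => /orP[] /eqP->; apply: cycle_edge_in.
have := cardsID Y [set g i; g i.+1].
rewrite card_set2I ?cycle_edge_succ // cards2 cycle_edge_succ.
have := matching_alternates i pmY; rewrite Y0 in_set0 addn0 => ->.
by rewrite add1n => -[].
Qed.

(** On the cycle, [Y] and its complement cover everything; elsewhere [X] is kept. *)
Lemma swap_on_sub X Y : X :|: Y \subset swap_on X Y :|: Y.
Proof.
apply/subsetP=> e; rewrite !inE.
by case: (e \in X) (e \in Y) (e \in es) => [] [] [].
Qed.

Lemma swap_on_cycle X Y e : e \in es -> e \in swap_on X Y :|: Y.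
Proof. by move=> es_e; rewrite !inE es_e andbT; case: (e \in Y). Qed.

End Cycle.

(** * Arcs in terms of indices *)

Section Arc.
Variables (T : eqType) (s : seq T) (x y : T).
Hypotheses (uniq_s : uniq s) (sx : x \in s) (sy : y \in s).
Hypothesis lt_xy : index x s < index y s.

(** As [x] precedes [y], the arc does not wrap around the end of [s]. *)
Lemma arc_take_drop :
  arc s x y = take (index y s - index x s) (drop (index x s) s).
Proof.
rewrite /arc /rot index_cat.
have y_take : y \notin take (index x s) s by rewrite in_take // -leqNgt ltnW.
have y_drop : y \in drop (index x s) s.
  by move: sy; rewrite -{1}(cat_take_drop (index x s) s) mem_cat (negPf y_take).
have := index_cat y (take (index x s) s) (drop (index x s) s).
rewrite cat_take_drop (negPf y_take) size_take index_mem sx => def_y.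
rewrite y_drop def_y addKn takel_cat //.
by rewrite ltnW // index_mem.
Qed.

Lemma size_arc : size (arc s x y) = index y s - index x s.
Proof.
by rewrite arc_take_drop size_takel // size_drop leq_sub2r // ltnW // index_mem.
Qed.

Lemma mem_arc_index z : z \in arc s x y -> index x s <= index z s < index y s.
Proof.
move=> /(nthP x)[j]; rewrite size_arc arc_take_drop => lt_j.
rewrite nth_take // nth_drop => <-.
have lt_y : index x s + j < index y s by rewrite addnC -ltn_subRL in lt_j *; lia.
by rewrite index_uniq ?leq_addr // (ltn_trans lt_y) // index_mem.
Qed.

End Arc.

(** * Cycle vertices incident with subsets of [M] *)

Section Incident.
Variables (G : graph) (M : {set edge G}).
Hypothesis pmM : perfect_matching M.
Implicit Types (A B : {set edge G}) (vs : seq (vertex G)).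

Lemma incident_onU A B vs :
  incident_on (A :|: B) vs = incident_on A vs :|: incident_on B vs.
Proof.
apply/setP=> v; rewrite !inE -andb_orr; congr (_ && _).
apply/existsP/orP => [[e /andP[/setUP[Ae|Be] ve]]|[]/existsP[e /andP[Xe ve]]].
- by left; apply/existsP; exists e; apply/andP.
- by right; apply/existsP; exists e; apply/andP.
- by exists e; rewrite inE Xe.
- by exists e; rewrite inE Xe orbT.
Qed.

(** An edge of [A] and one of [B] at the same vertex would both be the unique edge of [M] there. *)
Lemma incident_on_disjoint A B vs : A \subset M -> B \subset M ->
  [disjoint A & B] -> [disjoint incident_on A vs & incident_on B vs].
Proof.
move=> /subsetP sAM /subsetP sBM disAB; apply/pred0P=> v; apply/negP => /=.
rewrite !inE => /andP[/andP[_ /existsP[e /andP[Ae ve]]]].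
case/andP=> _ /existsP[f /andP[Bf vf]].
have /eqP/cards1P[m def_m] := perfect_matchingP _ pmM v.
have : e \in [set e in M | v \in ends e] by rewrite inE ve sAM.
have : f \in [set e in M | v \in ends e] by rewrite inE vf sBM.
rewrite def_m !inE => /eqP def_f /eqP def_e.
by move: (disjointFr disAB Ae); rewrite def_e -def_f Bf.
Qed.

End Incident.

(** * Odd cycles *)

Lemma odd_cycle_covered (G : graph) (M A B C X Y Z : {set edge G}) vs e0 es :
  (forall v, #|[set e in ~: M | v \in ends e]| = 2) ->
  perfect_matching M ->
  perfect_matching X -> perfect_matching Y -> perfect_matching Z ->
  M :&: X = A -> M :&: Y = B -> M :&: Z = C ->
  [disjoint A & B] -> [disjoint A & C] -> [disjoint B & C] ->
  cycle_in (~: M) vs (e0 :: es) ->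
  #|incident_on A vs| = 1 -> #|incident_on B vs| = 1 ->
  #|incident_on C vs| = 1 ->
  odd_division vs (incident_on (A :|: B :|: C) vs) ->
  e0 \in X :|: Y :|: Z.
Proof.
move=> M2 pmM pmX pmY pmZ XA YB ZC disAB disAC disBC cyc.
have uniq_vs : uniq vs by case/and5P: cyc.
have sAM : A \subset M by rewrite -XA subsetIl.
have sBM : B \subset M by rewrite -YB subsetIl.
have sCM : C \subset M by rewrite -ZC subsetIl.
have := incident_on_disjoint pmM vs sAM sBM disAB.
have := incident_on_disjoint pmM vs sAM sCM disAC.
have := incident_on_disjoint pmM vs sBM sCM disBC.
move=> dBC dAC dAB /eqP/cards1P[a def_a] /eqP/cards1P[b def_b] /eqP/cards1P[c def_c].
rewrite !incident_onU def_a def_b def_c => div_vs.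
rewrite def_a def_b def_c !disjoints1 !inE in dBC dAC dAB.
apply/negPn/negP; rewrite !inE !negb_or => /andP[/andP[e0X e0Y] e0Z].
have in_vs (D : {set edge G}) d : incident_on D vs = [set d] -> d \in vs.
  by move=> def_d; have := set11 d; rewrite -def_d inE => /andP[].
have [a_vs b_vs c_vs] := And3 (in_vs A a def_a) (in_vs B b def_b) (in_vs C c def_c).
have ne_index x y : x \in vs -> y \in vs -> x != y ->
    index x vs != index y vs.
  by move=> vs_x vs_y; apply: contra_neq => /(index_inj x vs_x vs_y).
(* The arc condition becomes one on positions, ready for arithmetic. *)
have gap x y : x \in [set a; b; c] -> y \in [set a; b; c] ->
    index x vs < index y vs ->
    (forall z, z \in [set a; b; c] ->
       ~~ (index x vs < index z vs < index y vs)) ->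
    odd (index y vs - index x vs).
  have sub_vs z : z \in [set a; b; c] -> z \in vs.
    by rewrite !inE => /orP[/orP[]|] /eqP->.
  move=> Tx Ty lt_xy none; rewrite -size_arc ?sub_vs //; apply: div_vs => //.
    by apply: contraTneq lt_xy => ->; rewrite ltnn.
  move=> z Tz /(mem_arc_index uniq_vs (sub_vs _ Tx) (sub_vs _ Ty) lt_xy).
  rewrite leq_eqVlt => /andP[/orP[/eqP eq_xz _ | lt_xz lt_zy]].
    exact/esym/(index_inj x (sub_vs _ Tx) (sub_vs _ Tz)).
  by have := none z Tz; rewrite lt_xz lt_zy.
(* [e0] has index 0 on the cycle and is uncovered, as [odd_trace_index] requires. *)
have odd_a : 0 < index a vs -> odd (index a vs).
  by apply: (odd_trace_index (e0 := e0) M2 a cyc pmX); rewrite ?XA.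
have odd_b : 0 < index b vs -> odd (index b vs).
  by apply: (odd_trace_index (e0 := e0) M2 b cyc pmY); rewrite ?YB.
have odd_c : 0 < index c vs -> odd (index c vs).
  by apply: (odd_trace_index (e0 := e0) M2 c cyc pmZ); rewrite ?ZC.
have Ta : a \in [set a; b; c] by rewrite !inE eqxx.
have Tb : b \in [set a; b; c] by rewrite !inE eqxx orbT.
have Tc : c \in [set a; b; c] by rewrite !inE eqxx orbT.
have gap3 x y : x \in [set a; b; c] -> y \in [set a; b; c] ->
    index x vs < index y vs ->
    ~~ (index x vs < index a vs < index y vs) ->
    ~~ (index x vs < index b vs < index y vs) ->
    ~~ (index x vs < index c vs < index y vs) ->
    odd (index y vs - index x vs).
  move=> Tx Ty lt_xy na nb nc; apply: gap => // z.
  by rewrite !inE => /orP[/orP[]|] /eqP->.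
have := ne_index _ _ a_vs b_vs dAB; have := ne_index _ _ a_vs c_vs dAC.
have := ne_index _ _ b_vs c_vs dBC.
move: (gap3 _ _ Ta Tb) (gap3 _ _ Tb Ta) (gap3 _ _ Ta Tc) (gap3 _ _ Tc Ta)
  (gap3 _ _ Tb Tc) (gap3 _ _ Tc Tb) odd_a odd_b odd_c.
(* The two larger of the three distinct positions are positive, hence odd, with an even difference;
   no third position lies between them, so [gap3] makes it odd. *)
move: (index a vs) (index b vs) (index c vs) => p q r; clear.
lia.
Qed.

(** * Even cycles and the enlarging step *)

Section Cover.
Variables (G : graph) (M : {set edge G}).
Hypothesis M2 : forall v, #|[set e in ~: M | v \in ends e]| = 2.
Implicit Types (X Y : {set edge G}).

Lemma even_cycle_swap X Y vs e es :
  perfect_matching X -> perfect_matching Y -> cycle_in (~: M) vs (e :: es) ->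
  incident_on (M :&: X) vs = set0 -> incident_on (M :&: Y) vs = set0 ->
  exists X', [/\ perfect_matching X', M :&: X' = M :&: X &
                 e |: (X :|: Y) \subset X' :|: Y].
Proof.
move=> pmX pmY cyc X0 Y0; exists (swap_on (e :: es) X Y).
(* [v] is the default vertex for [nth]. *)
have /card_gt0P[v _] : 0 < #|ends e| by rewrite card_ends.
split; first exact: (swap_on_perfect M2 v e cyc).
  exact: (swap_on_trace cyc).
rewrite subUset swap_on_sub andbT sub1set; apply: swap_on_cycle.
exact: mem_head.
Qed.

Lemma uncovered_swap X Y Z e :
  perfect_matching M ->
  perfect_matching X -> perfect_matching Y -> perfect_matching Z ->
  [disjoint M :&: X & M :&: Y] -> [disjoint M :&: X & M :&: Z] ->
  [disjoint M :&: Y & M :&: Z] ->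
  good_family M (M :&: X) (M :&: Y) (M :&: Z) ->
  e \notin M -> e \notin X :|: Y :|: Z ->
  exists X' Y' Z',
    [/\ [/\ perfect_matching X', perfect_matching Y' & perfect_matching Z'],
        [/\ M :&: X' = M :&: X, M :&: Y' = M :&: Y & M :&: Z' = M :&: Z] &
        e |: (X :|: Y :|: Z) \subset X' :|: Y' :|: Z'].
Proof.
move=> pmM pmX pmY pmZ dXY dXZ dYZ [oddF evenF] eM eXYZ.
have [|vs [es cyc]] := @cycle_through _ (~: M) M2 e; first by rewrite inE.
have [odd_vs | even_vs] := boolP (odd (size vs)).
  have [cA cB cC div_vs] := oddF _ _ cyc odd_vs.
  have := odd_cycle_covered M2 pmM pmX pmY pmZ erefl erefl erefl dXY dXZ dYZ
    cyc cA cB cC div_vs.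
  by rewrite (negPf eXYZ).
have := evenF _ _ cyc even_vs; rewrite /= addn0.
(* Two of the three traces miss the cycle; one matching of such a pair is swapped against the other,
   and the third is kept. *)
have [X0|_] := eqVneq (incident_on (M :&: X) vs) set0;
have [Y0|_] := eqVneq (incident_on (M :&: Y) vs) set0 => /=.
- have [X' [pmX' trX' sub]] := even_cycle_swap pmX pmY cyc X0 Y0.
  by exists X', Y, Z; split=> //; rewrite setUA setSU.
- case: eqVneq => // Z0 _.
  have [X' [pmX' trX' sub]] := even_cycle_swap pmX pmZ cyc X0 Z0.
  exists X', Y, Z; split=> //.
  by rewrite ![_ :|: Y :|: Z]setUAC setUA setSU.
- case: eqVneq => // Z0 _.
  have [Y' [pmY' trY' sub]] := even_cycle_swap pmY pmZ cyc Y0 Z0.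
  exists X, Y', Z; split=> //.
  by rewrite -!setUA setUCA setUS.
- by case: eqVneq.
Qed.

End Cover.

(** * The bound on [tau] and the extremal choice *)

Lemma tau_le (G : graph) (s : seq {set edge G}) :
  {in s, forall X, perfect_matching X} ->
  (forall e, exists2 X, X \in s & e \in X) ->
  exists2 k, tau G = Some k & k <= size s.
Proof.
move=> pm_s cov_s; pose F := [set X in s].
have covF : matching_cover F.
  apply/andP; split.
    by apply/forallP=> X; apply/implyP; rewrite inE => /pm_s.
  apply/eqP/setP=> e; rewrite inE; apply/bigcupP.
  by have [X sX eX] := cov_s e; exists X; rewrite ?inE.
(* The cover [F] excludes the value [None]. *)
rewrite /tau; case: pickP => [F0 covF0 | /(_ F)]; last by rewrite covF.
case: arg_minnP => // F1 _ minF1; exists #|F1| => //.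
by rewrite (leq_trans (minF1 F covF)) // cardsE card_size.
Qed.

Theorem theorem5p1 (G : graph) (M A B C : {set edge G}) :
  cubic G -> bridgeless G -> perfect_matching M ->
  balanced M A -> balanced M B -> balanced M C ->
  [disjoint A & B] -> [disjoint A & C] -> [disjoint B & C] ->
  good_family M A B C ->
  exists2 k, tau G = Some k & k <= 4.
Proof.
move=> cubG _ pmM [X0 pmX0 XA] [Y0 pmY0 YB] [Z0 pmZ0 ZC] dAB dAC dBC goodF.
(* Of the three edges at [v], exactly one is in [M]. *)
have M2 v : #|[set e in ~: M | v \in ends e]| = 2.
  have := cubG v; rewrite -(cardsID M).
  have -> : [set e | v \in ends e] :&: M = [set e in M | v \in ends e].
    by apply/setP=> e; rewrite !inE andbC.
  have -> : [set e | v \in ends e] :\: M = [set e in ~: M | v \in ends e].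
    by apply/setP=> e; rewrite !inE.
  by rewrite (perfect_matchingP _ pmM) => -[].
pose admissible (t : {set edge G} * {set edge G} * {set edge G}) :=
  [&& perfect_matching t.1.1, perfect_matching t.1.2, perfect_matching t.2,
      M :&: t.1.1 == A, M :&: t.1.2 == B & M :&: t.2 == C].
pose union (t : {set edge G} * {set edge G} * {set edge G}) :=
  t.1.1 :|: t.1.2 :|: t.2.
have adm0 : admissible (X0, Y0, Z0).
  by rewrite /admissible /= pmX0 pmY0 pmZ0 XA YB ZC !eqxx.
have [[[X Y] Z]] := arg_maxnP (fun t => #|union t|) adm0.
case/and5P=> /= pmX pmY pmZ /eqP trX /andP[/eqP trY /eqP trZ] maxXYZ.
apply: (@tau_le G [:: M; X; Y; Z]) => [W|e].
  by rewrite !inE => /or4P[] /eqP->.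
suff : (e \in M) || (e \in union (X, Y, Z)).
  rewrite !inE /= => /or3P[Me|/orP[Xe|Ye]|Ze].
  - by exists M; rewrite // !inE eqxx.
  - by exists X; rewrite // !inE eqxx ?orbT.
  - by exists Y; rewrite // !inE eqxx ?orbT.
  - by exists Z; rewrite // !inE eqxx ?orbT.
apply/norP=> -[eM eXYZ].
(* The good family now consists of the traces of the maximal triple. *)
rewrite -trX -trY -trZ in dAB dAC dBC goodF.
have [X' [Y' [Z' [[pmX' pmY' pmZ'] [trX' trY' trZ'] sub]]]] :=
  uncovered_swap M2 pmM pmX pmY pmZ dAB dAC dBC goodF eM eXYZ.
have adm' : admissible (X', Y', Z').
  by rewrite /admissible /= pmX' pmY' pmZ' trX' trY' trZ' trX trY trZ !eqxx.
have := maxXYZ _ adm'; rewrite leqNgt => /negP; apply.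
(* The new union contains the old one and also [e], so it is strictly larger. *)
by apply: leq_trans (subset_leq_card sub); rewrite cardsU1 eXYZ.
Qed.
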